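(* Let $\Delta:\mathbb{N}^{(2)}\rightarrow\mathbb{N}\cup\{\mathbf{0}\}$ be a colouring whose image is infinite. Then at least one of the following holds: (i) for every $m\in\mathbb{N}$ there is $X\subset\mathbb{N}$ with $\gamma(X)=m$; (ii) there exists an infinite rainbow coloured subset of $\mathbb{N}$; (iii) there exists an infinite star coloured subset of $\mathbb{N}$.
   Context: $\mathbb{N}^{(2)}$ is the set of unordered pairs of natural numbers (edges of the complete graph on $\mathbb{N}$); $\mathbf{0}$ is a special colour not in $\mathbb{N}$. For $X\subset\mathbb{N}$, $\gamma(X)=|\Delta(X^{(2)})\setminus\{\mathbf{0}\}|$, the number of distinct colours other than $\mathbf{0}$ on edges with both endpoints in $X$. A set $X$ is rainbow coloured if no two distinct edges within $X$ receive the same value of $\Delta$; $X$ is star coloured if there is $v\in X$ such that all edges within $X\setminus\{v\}$ receive the same value of $\Delta$ and the edges between $v$ and $X\setminus\{v\}$ receive pairwise distinct values, all different from that common value (here $\mathbf{0}$ is treated as an ordinary value of $\Delta$). *)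

(* Defs.v *)
From mathcomp Require Import all_boot finmap.
From mathcomp Require Import boolp classical_sets functions cardinality.

Set Implicit Arguments.
Unset Strict Implicit.
Unset Printing Implicit Defensive.

Local Open Scope classical_set_scope.
Local Open Scope card_scope.

(* N^(2): an edge is a two-element set of natural numbers. *)
Definition edge : Type := {e : {fset nat} | #|` e|%fset == 2}.

(* N together with the special colour 0, which is [None]. *)
Definition colour : Type := option nat.

Definition edges (X : set nat) : set edge :=
  [set e | forall x : nat, x \in sval e -> X x].

(* gamma(X) = m, as an equipotence since gamma(X) may be infinite. *)
Definition gamma_eq (Delta : edge -> colour) (X : set nat) (m : nat) : Prop :=
  ((Delta @` edges X) `\ None) #= `I_m.

Definition rainbow (Delta : edge -> colour) (X : set nat) : Prop :=
  forall e f : edge, edges X e -> edges X f -> e <> f -> Delta e <> Delta f.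

Definition star_edges (v : nat) (X : set nat) : set edge :=
  [set e | edges X e /\ v \in sval e].

Definition star_coloured (Delta : edge -> colour) (X : set nat) : Prop :=
  exists v : nat, X v /\
  exists c : colour,
    [/\ forall e : edge, edges (X `\ v) e -> Delta e = c,
        forall e f : edge, star_edges v X e -> star_edges v X f ->
          e <> f -> Delta e <> Delta f
      & forall e : edge, star_edges v X e -> Delta e <> c].

(* Main.v *)
(**
Say that a vertex [x] is constant along an ultrafilter if almost all edges at
[x] have one colour, its limit colour.

Suppose some vertex [v] sees infinitely many colours, and take an ultrafilter
along which [v] is not constant.  If almost all vertices are constant, then
either the limit colour is essentially constant, and a greedy choice gives a
monochromatic infinite set which forms a star with [v], or it takes each value
rarely, and a greedy choice gives vertices [x_i] whose edges [x_i x_j], [i < j],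
have a colour depending injectively on [i]; finite subsets then have every
[gamma].  If almost all vertices are non-constant, comparing two vertices by
whether they almost always agree yields either the same picture with the colour
depending on [j], or an infinite rainbow set.

Otherwise every vertex is constant along every ultrafilter.  Choose pairs
[a_i b_i] with distinct non-zero colours and a free ultrafilter on the indices.
Either some limit colour along [a] or [b] is not essentially constant, and every
[gamma] is again found directly, or after passing to a subsequence the colours
of [a_i a_j], [a_i b_j], [b_i a_j], [b_i b_j], [i < j], are four constants.
The vertices can then be added in an order in which each of them creates at most
one new colour, so that [gamma] takes every value.
*)
Require Import Defs.
From mathcomp Require Import all_boot finmap.
From mathcomp Require Import boolp classical_sets functions cardinality filter.

Set Implicit Arguments.
Unset Strict Implicit.
Unset Printing Implicit Defensive.

Local Open Scope classical_set_scope.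

(** * Colours of pairs of vertices *)

Lemma pair_edge_subproof (x y : nat) (hxy : x != y) :
  #|` [fset x; y]|%fset == 2.
Proof. by rewrite cardfs2 hxy. Qed.

Definition pair_edge (x y : nat) (hxy : x != y) : edge :=
  exist _ [fset x; y]%fset (pair_edge_subproof hxy).

(* The loop [x, x] is given the colour 0, which [gamma] ignores; vertex lists
   may therefore contain repetitions. *)
Definition col (Delta : edge -> colour) (x y : nat) : colour :=
  if eqVneq x y is NeqNotEq hxy then Delta (pair_edge hxy) else None.

Lemma colE (Delta : edge -> colour) (e : edge) (x y : nat) :
  x != y -> sval e = [fset x; y]%fset -> Delta e = col Delta x y.
Proof.
move=> hxy ee; rewrite /col.
case: eqVneq hxy => [//|h _].
by congr Delta; apply: val_inj.
Qed.

Lemma edgeP (e : edge) : exists x y : nat, x != y /\ sval e = [fset x; y]%fset.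
Proof.
case: e => A /=; have := fset_uniq A; case E : (enum_fset A) => [|x [|y [|]]] //=.
rewrite inE andbT => hxy _; exists x, y; split=> //.
by apply/fsetP => z; rewrite -[z \in A]/(z \in enum_fset A) E !inE.
Qed.

Lemma colxx (Delta : edge -> colour) (x : nat) : col Delta x x = None.
Proof. by rewrite /col; case: eqVneq => [//|h]; have := h; rewrite eqxx. Qed.

Lemma colC (Delta : edge -> colour) (x y : nat) : col Delta x y = col Delta y x.
Proof.
have [->//|h] := eqVneq x y.
rewrite -(@colE Delta (pair_edge h) x y) //.
by apply: colE; rewrite 1?eq_sym //= fsetUC.
Qed.

(** * Counting colours on finite vertex lists *)

Definition cols (Delta : edge -> colour) (s : seq nat) : seq colour :=
  undup [seq c <- [seq col Delta x y | x <- s, y <- s] | c != None].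

Definition gam (Delta : edge -> colour) (s : seq nat) : nat :=
  size (cols Delta s).

Lemma mem_cols (Delta : edge -> colour) (s : seq nat) (c : colour) :
  c \in cols Delta s <->
  c <> None /\ exists x y, [/\ x \in s, y \in s & c = col Delta x y].
Proof.
rewrite /cols mem_undup mem_filter; split.
  case/andP => /eqP h /allpairsP [[x y] /= [hx hy e]].
  by split=> //; exists x, y.
case=> /eqP -> [x [y [hx hy ->]]] /=.
by apply/allpairsP; exists (x, y).
Qed.

Lemma gamma_eq_gam (Delta : edge -> colour) (s : seq nat) :
  gamma_eq Delta [set` s] (gam Delta s).
Proof.
have -> : gam Delta s = #|` [fset c in cols Delta s]|%fset.
  rewrite card_fseq undup_id //; exact: undup_uniq.
rewrite /gamma_eq.
suff -> : (Delta @` edges [set` s]) `\ None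
          = [set` [fset c in cols Delta s]%fset] by apply/card_eq_fsetP.
apply/seteqP; split => c /=.
  case=> -[e he <-] hn; rewrite in_fset /=; apply/mem_cols; split=> //.
  have [x [y [hxy ee]]] := edgeP e.
  exists x, y; split; last exact: colE.
    by apply: he; rewrite ee !inE eqxx.
  by apply: he; rewrite ee !inE eqxx orbT.
rewrite in_fset /= => /mem_cols [hn [x [y [hx hy hc]]]]; split=> //.
have [exy|hxy] := eqVneq x y; first by rewrite hc exy colxx in hn.
exists (pair_edge hxy); last by rewrite hc; apply: colE.
by move=> z /=; rewrite !inE => /orP [] /eqP ->.
Qed.

Definition all_gammas (Delta : edge -> colour) : Prop :=
  forall m : nat, exists X : set nat, gamma_eq Delta X m.

Lemma all_gammas_gam (Delta : edge -> colour) :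
  (forall m, exists s, gam Delta s = m) -> all_gammas Delta.
Proof.
by move=> h m; have [s <-] := h m; exists [set` s]; exact: gamma_eq_gam.
Qed.

Lemma gam_eq_size (Delta : edge -> colour) (s : seq nat) (t : seq colour) :
  uniq t -> {subset t <= cols Delta s} ->
  (forall x y, x \in s -> y \in s -> col Delta x y \in None :: t) ->
  gam Delta s = size t.
Proof.
move=> ut hts hst; apply/eqP; rewrite eqn_leq; apply/andP; split.
  apply: uniq_leq_size => [|c /mem_cols [hn [x [y [hx hy ec]]]]].
    exact: undup_uniq.
  by have := hst _ _ hx hy; rewrite -ec inE => /orP [/eqP|].
exact: uniq_leq_size.
Qed.

Lemma mem_mkseqP (T : eqType) (x : nat -> T) (n : nat) (z : T) :
  z \in mkseq x n -> exists2 i, i < n & z = x i.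
Proof. by case/mapP => i; rewrite mem_iota /= => hi ->; exists i. Qed.

Lemma mem_mkseq (T : eqType) (x : nat -> T) (n i : nat) :
  i < n -> x i \in mkseq x n.
Proof. by move=> hi; apply: map_f; rewrite mem_iota. Qed.

Lemma uniq_mkseq (T : eqType) (x : nat -> T) (n : nat) :
  (forall i j, i < j -> x i <> x j) -> uniq (mkseq x n).
Proof.
move=> h; rewrite map_inj_uniq ?iota_uniq // => i j e.
by case: (ltngtP i j) => // /h; rewrite e.
Qed.

Lemma col_mkseq (Delta : edge -> colour) (x : nat -> nat) (n : nat)
    (t : seq colour) :
  (forall i j, i < j < n -> col Delta (x i) (x j) \in None :: t) ->
  forall y z, y \in mkseq x n -> z \in mkseq x n ->
    col Delta y z \in None :: t.
Proof.
move=> h y z /mem_mkseqP [i hi ->] /mem_mkseqP [j hj ->].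
case: (ltngtP i j) => hij; last by rewrite hij colxx inE eqxx.
  by apply: h; rewrite hij.
by rewrite colC; apply: h; rewrite hij.
Qed.

(** Among the first [m.+1] terms the last is never the earlier end of an edge, so exactly the first
    [m] values of [g] occur. *)
Lemma all_gammas_min (Delta : edge -> colour) (x : nat -> nat)
    (g : nat -> colour) :
  (forall i, g i <> None) ->
  (forall i j, i < j -> col Delta (x i) (x j) = g i /\ g i <> g j) ->
  all_gammas Delta.
Proof.
move=> hn h; apply: all_gammas_gam => m; exists (mkseq x m.+1).
rewrite (@gam_eq_size _ _ (mkseq g m)) ?size_mkseq //.
- by apply: uniq_mkseq => i j /h [].
- move=> c /mem_mkseqP [i hi ->]; apply/mem_cols; split; first exact: hn.
  exists (x i), (x m); split; [exact/mem_mkseq/ltnW|exact: mem_mkseq|].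
  by have [->] := h _ _ hi.
- apply: col_mkseq => i j /andP [hij hj].
  have [-> _] := h _ _ hij.
  by rewrite inE mem_mkseq ?orbT //; apply: leq_trans hij _.
Qed.

(** Here [x 0] is never the later end of an edge, so [g 0] does not occur; hence the shift
    [g \o succn]. *)
Lemma all_gammas_max (Delta : edge -> colour) (x : nat -> nat)
    (g : nat -> colour) :
  (forall i, g i <> None) ->
  (forall i j, i < j -> col Delta (x i) (x j) = g j /\ g i <> g j) ->
  all_gammas Delta.
Proof.
move=> hn h; apply: all_gammas_gam => m; exists (mkseq x m.+1).
rewrite (@gam_eq_size _ _ (mkseq (g \o succn) m)) ?size_mkseq //.
- by apply: uniq_mkseq => i j hij; have [] := h i.+1 j.+1 hij.
- move=> c /mem_mkseqP [i hi ->] /=; apply/mem_cols; split; first exact: hn.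
  exists (x 0), (x i.+1); split; try exact: mem_mkseq.
  by have [->] := h 0 i.+1 isT.
- apply: col_mkseq => i [//|j] /andP [hij hj].
  have [-> _] := h _ _ hij.
  by rewrite inE (@mem_mkseq _ (g \o succn)) ?orbT.
Qed.

(** * Greedy choice along a filter *)

(** Dependent choice on finite prefixes: [Good] is the invariant that keeps the construction going,
    [L] is what a new term must satisfy with respect to its predecessors. *)
Lemma greedy (T : choiceType) (t0 : T) (Good : seq T -> Prop)
    (L : seq T -> T -> Prop) :
  Good [::] ->
  (forall s, Good s -> exists z, L s z /\ Good (rcons s z)) ->
  exists x : nat -> T, forall n, L (mkseq x n) (x n).
Proof.
move=> h0 hs.
pose nxt s := xget t0 [set z | L s z /\ Good (rcons s z)].
pose b := fix b n := if n is k.+1 then rcons (b k) (nxt (b k)) else [::].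
have bE n : b n = mkseq (fun k => nxt (b k)) n.
  by elim: n => //= n {1}->; rewrite mkseqS.
have hb n : Good (b n).
  by elim: n => //= n /hs /(xgetPex t0) [].
exists (fun k => nxt (b k)) => n; rewrite -bE.
by have /(xgetPex t0) [] := hs _ (hb n).
Qed.

Lemma filter_all (T S : eqType) (U : set_system T) {FU : Filter U}
    (s : seq S) (P : S -> set T) :
  (forall x, x \in s -> U (P x)) ->
  U [set z | forall x, x \in s -> P x z].
Proof.
elim: s => [|a s ih] h; first by apply: filterS filterT.
have h1 : U (P a) by apply: h; rewrite inE eqxx.
have h2 := ih (fun x hx => h x (@mem_behead _ (a :: s) x hx)).
apply: filterS (filterI h1 h2) => z [/= pa ps] x; rewrite inE => /orP [/eqP ->//|].
exact: ps.
Qed.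

(** Finitely many predecessors impose finitely many sets of [U], whose intersection with [A] is
    still in [U], hence non-empty. *)
Lemma greedy_pair (U : set_system nat) (FU : ProperFilter U) (A : set nat)
    (P : nat -> set nat) :
  U A -> (forall x, A x -> U (P x)) ->
  exists x : nat -> nat,
    (forall n, A (x n)) /\ forall i j, i < j -> P (x i) (x j).
Proof.
move=> hA hP.
pose L (s : seq nat) z := A z /\ forall x, x \in s -> P x z.
have [] := @greedy _ 0 (fun s : seq nat => forall x, x \in s -> A x) L => //.
  move=> s hs.
  have /filter_ex [z [h1 h2]] :
      U (A `&` [set z | forall x, x \in s -> P x z]).
    by apply: filterI => //; apply: filter_all => x /hs /hP.
  exists z; split; first by [].
  by move=> x; rewrite mem_rcons inE => /orP [/eqP ->|/hs].
move=> x hx; exists x; split=> [n|i j hij]; first by case: (hx n).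
by case: (hx j) => _; apply; apply: mem_mkseq.
Qed.

(** * Limit colours along an ultrafilter *)

Definition essconst (U : set_system nat) (f : nat -> colour) : Prop :=
  exists c, U [set y | f y = c].

Definition ess_value (U : set_system nat) (f : nat -> colour) : colour :=
  xget None [set c | U [set y | f y = c]].

Lemma ess_valueP (U : set_system nat) (f : nat -> colour) :
  essconst U f -> U [set y | f y = ess_value U f].
Proof. exact: (@xgetPex _ None [set c | U [set y | f y = c]]). Qed.

Lemma nessconstP (U : set_system nat) (UU : UltraFilter U) (f : nat -> colour) :
  ~ essconst U f -> forall c, U [set y | f y <> c].
Proof.
move=> h c; have [hc|//] := in_ultra_setVsetC [set y | f y = c] UU.
by case: h; exists c.
Qed.

Lemma essconst_finite (U : set_system nat) (UU : UltraFilter U)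
    (f : nat -> colour) :
  finite_set (range f) -> essconst U f.
Proof.
move=> /finite_seqP [s es]; apply: contrapT => /(nessconstP UU) h.
have /filter_ex [y /(_ (f y))] : U [set y | forall c, c \in s -> f y <> c].
  by apply: (@filter_all _ _ U _ s (fun c => [set y | f y <> c])) => c _.
apply=> //.
have : range f (f y) by exists y.
by rewrite es.
Qed.

(** The sets whose complement has finite image under [f] form a proper filter, because the whole
    image is infinite; an ultrafilter above it contains the complement of every fibre. *)
Lemma ultra_of_infinite (T : Type) (f : nat -> T) :
  infinite_set (range f) ->
  exists U : set_system nat, UltraFilter U /\ forall c, U [set y | f y <> c].
Proof.
move=> hf.
pose F : set_system nat := [set S | finite_set (f @` (~` S))].
have FF : ProperFilter F.
  split; first by rewrite /F /= setC0.
  split; first by rewrite /F /= setCT image_set0; exact: finite_set0.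
    by move=> P Q hP hQ; rewrite /F /= setCI image_setU finite_setU.
  move=> P Q PQ; apply: sub_finite_set; apply: image_subset.
  by move=> z hz /PQ.
have [U [UU FU]] := ultraFilterLemma FF.
exists U; split=> // c; apply: FU.
apply: (@sub_finite_set _ _ [set c]); last exact: finite_set1.
by move=> d [y /= /contrapT <- <-].
Qed.

(** A greedy choice makes the limit colours non-zero and pairwise distinct, and gives each edge the
    limit colour of its earlier end. *)
Lemma all_gammas_ultra_min (Delta : edge -> colour) (U : set_system nat)
    (UU : UltraFilter U) (a : nat -> nat) (phi : nat -> colour) :
  U [set i | U [set j | col Delta (a i) (a j) = phi i]] ->
  (forall c, U [set i | phi i <> c]) ->
  all_gammas Delta.
Proof.
move=> h1 h2.
have [] := @greedy_pair U _
  ([set i | U [set j | col Delta (a i) (a j) = phi i]]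
     `&` [set i | phi i <> None])
  (fun i => [set j | col Delta (a i) (a j) = phi i]
     `&` [set j | phi j <> phi i]).
- exact: filterI.
- by move=> x [hx _]; apply: filterI.
move=> x [hA hP]; apply: (@all_gammas_min _ (a \o x) (phi \o x)).
  by move=> i; case: (hA i).
by move=> i j /hP [h h']; split=> //; apply/nesym.
Qed.

(** * Rainbow and star sets from sequences *)

Lemma edges_range (Delta : edge -> colour) (z : nat -> nat) (e : edge) :
  edges (range z) e ->
  exists i j, [/\ i < j, sval e = [fset z i; z j]%fset
                & Delta e = col Delta (z i) (z j)].
Proof.
have [x [y [hxy ee]]] := edgeP e => he.
have [i _ ei] : range z x by apply: he; rewrite ee !inE eqxx.
have [j _ ej] : range z y by apply: he; rewrite ee !inE eqxx orbT.
rewrite -ei -ej in hxy ee.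
case: (ltngtP i j) hxy => [hij|hij|->] hxy; last by rewrite eqxx in hxy.
  by exists i, j; split=> //; apply: colE.
exists j, i; split=> //; first by rewrite ee fsetUC.
by rewrite colC; apply: colE.
Qed.

Lemma infinite_range_lt (T : Type) (z : nat -> T) :
  (forall i j, i < j -> z i <> z j) -> infinite_set (range z).
Proof.
move=> h.
have inj : {in [set: nat] &, injective z}.
  by move=> i j _ _ e; case: (ltngtP i j) => // /h; rewrite e.
by rewrite (eq_finite_set (inj_card_eq inj)); exact: infinite_nat.
Qed.

(** Edges are compared by their later ends: the first hypothesis treats a common later end, the
    second two different ones. *)
Lemma rainbow_range (Delta : edge -> colour) (z : nat -> nat) :
  (forall i j k, i < k -> j < k -> i <> j ->
     col Delta (z i) (z k) <> col Delta (z j) (z k)) ->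
  (forall i j l k, i < k -> j < k -> l < k ->
     col Delta (z i) (z k) <> col Delta (z j) (z l)) ->
  rainbow Delta (range z).
Proof.
move=> h1 h2 e f /(edges_range Delta) [i [k [ik ee ->]]].
move=> /(edges_range Delta) [j [l [jl ef ->]]] nef.
case: (ltngtP k l) => [kl|lk|ekl].
- by apply: nesym; apply: h2 => //; apply: ltn_trans ik kl.
- by apply: h2 => //; apply: ltn_trans jl lk.
rewrite -ekl in jl ef *; apply: h1 => // eij.
by apply: nef; apply: val_inj => /=; rewrite ee ef eij.
Qed.

Lemma star_coloured_range (Delta : edge -> colour) (v : nat) (x : nat -> nat)
    (c : colour) :
  (forall i, x i <> v) ->
  (forall i, col Delta v (x i) <> c) ->
  (forall i j, i < j -> col Delta (x i) (x j) = c) ->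
  (forall i j, i < j -> col Delta v (x i) <> col Delta v (x j)) ->
  star_coloured Delta (v |` range x).
Proof.
move=> hv hc hx hd; exists v; split; first by left.
exists c.
have star e : star_edges v (v |` range x) e ->
    exists i, sval e = [fset v; x i]%fset /\ Delta e = col Delta v (x i).
  case=> he; have [y [z [hyz ee]]] := edgeP e.
  have rg w : w \in sval e -> w != v -> exists i, w = x i.
    move=> we wv; case: (he w we) => [/= ew|[i _ <-]]; last by exists i.
    by rewrite ew eqxx in wv.
  rewrite ee !inE => /orP [] /eqP ev.
    have [i ei] : exists i, z = x i.
      by apply: rg; [rewrite ee !inE eqxx orbT|rewrite ev eq_sym].
    exists i; rewrite ev -ei; split=> //; exact: colE.
  have [i ei] : exists i, y = x i.
    by apply: rg; [rewrite ee !inE eqxx|rewrite ev].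
  exists i; rewrite ev -ei colC; split; [by rewrite fsetUC|exact: colE].
split.
- move=> e he; have [|i [j [ij _ ->]]] := @edges_range Delta x e; last exact: hx.
  by move=> y /he /= [[//|]].
- move=> e f /star [i [ee ->]] /star [j [ef ->]] nef.
  case: (ltngtP i j) => ij; [exact: hd|exact/nesym/hd|].
  by case: nef; apply: val_inj => /=; rewrite ee ef ij.
- by move=> e /star [i [_ ->]].
Qed.

(** * A vertex with infinitely many colours *)

(** Vertices that almost always agree with [v] copy its colours, so in a greedy sequence each edge
    takes the colour from [v] to its later end. *)
Lemma ultra_max (Delta : edge -> colour) (U : set_system nat)
    (UU : UltraFilter U) (v : nat) :
  ~ essconst U (col Delta v) ->
  U [set x | U [set y | col Delta x y = col Delta v y]] ->
  all_gammas Delta.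
Proof.
move=> /(nessconstP UU) hv hE.
have [] := @greedy_pair U _
  ([set x | U [set y | col Delta x y = col Delta v y]]
     `&` [set x | col Delta v x <> None])
  (fun x => [set y | col Delta x y = col Delta v y]
     `&` [set y | col Delta v y <> col Delta v x]).
- exact: filterI.
- by move=> x [hx _]; apply: filterI.
move=> x [hA hP]; apply: (@all_gammas_max _ x (col Delta v \o x)).
  by move=> i; case: (hA i).
by move=> i j /hP [h h']; split=> //; apply/nesym.
Qed.

Lemma ultra_rainbow (Delta : edge -> colour) (U : set_system nat)
    (UU : UltraFilter U) (A : set nat) :
  (forall x, U [set y | y <> x]) ->
  U A ->
  (forall x, A x -> ~ essconst U (col Delta x)) ->
  (forall x, A x -> U [set y | U [set z | col Delta x z <> col Delta y z]]) ->
  exists X : set nat, infinite_set X /\ rainbow Delta X.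
Proof.
move=> free hA hnc hne.
pose sep x y := U [set z | col Delta x z <> col Delta y z].
have sepC x y : sep x y -> sep y x.
  by apply: filterS => z /= h /esym.
(* Non-constancy of the chosen vertices lets almost every new vertex bring new colours; pairwise
   separation lets it bring distinct ones. *)
pose Good (s : seq nat) := (forall x, x \in s -> A x) /\
  forall x y, x \in s -> y \in s -> x <> y -> sep x y.
pose L (s : seq nat) z := [/\ forall x, x \in s -> z <> x,
  forall x y, x \in s -> y \in s -> x <> y -> col Delta x z <> col Delta y z
  & forall x y w, x \in s -> y \in s -> w \in s ->
      col Delta x z <> col Delta y w].
have [] := @greedy _ 0 Good L => //.
  move=> s [gA gs].
  have h1 : U [set z | forall x, x \in s -> z <> x].
    by apply: (@filter_all _ _ U _ s (fun x => [set z | z <> x])) => x _.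
  have h2 : U [set z | forall x, x \in s -> sep x z].
    by apply: (@filter_all _ _ U _ s (fun x => [set z | sep x z])) => x /gA /hne.
  have h3 : U [set z | forall x, x \in s -> forall y, y \in s ->
      x <> y -> col Delta x z <> col Delta y z].
    apply: (@filter_all _ _ U _ s (fun x => [set z | forall y, y \in s ->
      x <> y -> col Delta x z <> col Delta y z])) => x xs.
    apply: (@filter_all _ _ U _ s (fun y => [set z |
      x <> y -> col Delta x z <> col Delta y z])) => y ys.
    have [->|nxy] := pselect (x = y); first by apply: filterS filterT => z _ [].
    by apply: filterS (gs _ _ xs ys nxy) => z h _.
  have h4 : U [set z | forall x, x \in s -> forall y, y \in s ->
      forall w, w \in s -> col Delta x z <> col Delta y w].
    apply: (@filter_all _ _ U _ s (fun x => [set z | forall y, y \in s ->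
      forall w, w \in s -> col Delta x z <> col Delta y w])) => x xs.
    apply: (@filter_all _ _ U _ s (fun y => [set z |
      forall w, w \in s -> col Delta x z <> col Delta y w])) => y ys.
    apply: (@filter_all _ _ U _ s (fun w => [set z |
      col Delta x z <> col Delta y w])) => w ws.
    exact: (nessconstP UU (hnc _ (gA _ xs))).
  have [z [zA [[z1 z2] [z3 z4]]]] :=
    filter_ex (filterI hA (filterI (filterI h1 h2) (filterI h3 h4))).
  exists z; split.
    split=> //; first by move=> x y xs ys; apply: z3.
    by move=> x y w xs ys ws; apply: z4.
  split=> [x|x y]; rewrite !mem_rcons !inE.
    by case/orP => [/eqP ->|/gA].
  case/orP => [/eqP ->|xs] /orP [/eqP ->|ys] // nxy; last exact: gs.
    exact/sepC/z2.
  exact: z2.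
move=> x hx; exists (range x).
have inj i j : i < j -> x i <> x j.
  by move=> ij; have [h _ _] := hx j; apply/nesym/h/mem_mkseq.
split; first exact: infinite_range_lt.
apply: rainbow_range.
  move=> i j k ik jk nij; have [_ h _] := hx k.
  apply: h; try exact: mem_mkseq.
  by move=> e; case: (ltngtP i j) => // /inj; rewrite e.
move=> i j l k ik jk lk; have [_ _ h] := hx k.
by apply: h; apply: mem_mkseq.
Qed.

Lemma canonical_ultra (Delta : edge -> colour) (U : set_system nat)
    (UU : UltraFilter U) :
  (forall x, U [set y | y <> x]) ->
  [\/ all_gammas Delta,
      exists X : set nat, infinite_set X /\ rainbow Delta X
    | exists c, U [set x | U [set y | col Delta x y = c]]].
Proof.
move=> free.
have [hc|hnc] := in_ultra_setVsetC [set x | essconst U (col Delta x)] UU.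
  pose phi x := ess_value U (col Delta x).
  have hphi : U [set x | U [set y | col Delta x y = phi x]].
    by apply: filterS hc => x; exact: ess_valueP.
  have [[c hcc]|/(nessconstP UU) hn] := pselect (essconst U phi).
    constructor 3; exists c; apply: filterS (filterI hphi hcc) => x [h /= <-].
    exact: h.
  by constructor 1; apply: (@all_gammas_ultra_min _ U UU id phi).
(* Almost all vertices are now non-constant; the question is whether almost all of them copy a
   single non-constant one. *)
have [[v [nv hv]]|hn] := pselect (exists v, ~ essconst U (col Delta v) /\
    U [set x | U [set y | col Delta x y = col Delta v y]]).
  by constructor 1; apply: ultra_max hv.
constructor 2; apply: ultra_rainbow (free) hnc _ _ => // x nx.
have [hx|] := in_ultra_setVsetC
  [set y | U [set z | col Delta y z = col Delta x z]] UU.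
  by case: hn; exists x.
apply: filterS => y /= ny.
have [//|] := in_ultra_setVsetC [set z | col Delta y z = col Delta x z] UU.
by apply: filterS => z /= nz /esym.
Qed.

Lemma infinite_degree (Delta : edge -> colour) (v : nat) :
  infinite_set (range (col Delta v)) ->
  [\/ all_gammas Delta,
      exists X : set nat, infinite_set X /\ rainbow Delta X
    | exists X : set nat, infinite_set X /\ star_coloured Delta X].
Proof.
move=> /ultra_of_infinite [U [UU hU]].
(* Almost all [y] avoid the colour [col Delta v x], which [x] itself does not. *)
have free x : U [set y | y <> x].
  by apply: filterS (hU (col Delta v x)) => y /= h e; apply: h; rewrite e.
have [?|?|[c hc]] := canonical_ultra Delta UU free;
  [by constructor 1|by constructor 2|constructor 3].
(* The remaining case: vertices joined in colour [c], whose colours to [v] are distinct and differ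
   from [c], form a star centred at [v]. *)
have [] := @greedy_pair U _
  ([set x | U [set y | col Delta x y = c]]
     `&` ([set x | x <> v] `&` [set x | col Delta v x <> c]))
  (fun x => [set y | col Delta x y = c]
     `&` [set y | col Delta v y <> col Delta v x]).
- exact/filterI/filterI.
- by move=> x [hx _]; apply: filterI.
move=> x [hA hP]; exists (v |` range x); split.
  apply: (@sub_infinite_set _ (range x)); first by move=> ?; right.
  by apply: infinite_range_lt => i j /hP [_ /= h] e; apply: h; rewrite e.
apply: (@star_coloured_range _ _ _ c).
- by move=> i; case: (hA i) => _ [].
- by move=> i; case: (hA i) => _ [].
- by move=> i j /hP [].
- by move=> i j /hP [_ h]; apply/nesym.
Qed.

(** * A monochromatic sequence with varying cross colours *)

Lemma gam_triangle (Delta : edge -> colour) (x y z : nat) (t : seq colour) :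
  uniq t -> None \notin t ->
  {subset t <= [:: col Delta x y; col Delta x z; col Delta y z]} ->
  {subset [:: col Delta x y; col Delta x z; col Delta y z] <= None :: t} ->
  gam Delta [:: x; y; z] = size t.
Proof.
move=> ut nt h1 h2; apply: gam_eq_size => // [c ct|u v].
  apply/mem_cols; split; first by move=> ec; rewrite -ec ct in nt.
  move: (h1 _ ct); rewrite !inE => /or3P [] /eqP ->.
  - by exists x, y; rewrite !inE !eqxx ?orbT.
  - by exists x, z; rewrite !inE !eqxx ?orbT.
  - by exists y, z; rewrite !inE !eqxx ?orbT.
have hxy : col Delta x y \in None :: t by apply: h2; rewrite !inE eqxx.
have hxz : col Delta x z \in None :: t by apply: h2; rewrite !inE eqxx ?orbT.
have hyz : col Delta y z \in None :: t by apply: h2; rewrite !inE eqxx ?orbT.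
move=> hu hv; rewrite !inE in hu hv.
by case/or3P: hu => /eqP ->; case/or3P: hv => /eqP ->;
  rewrite ?colxx ?mem_head // colC.
Qed.

(** Choose [n] terms spanning only colour [p], and an apex joined to them in [n] distinct colours:
    this shows [n] non-zero colours, plus [p] if it is non-zero and [n] is at least 2. For non-zero
    [p], the counts below 3 are treated apart. *)
Lemma all_gammas_cross (Delta : edge -> colour) (U : set_system nat)
    (UU : UltraFilter U) (a b : nat -> nat) (p : colour) (g : nat -> colour) :
  U [set i | U [set j | col Delta (a i) (a j) = p]] ->
  U [set i | U [set j | col Delta (a i) (b j) = g i]] ->
  (forall c, U [set i | g i <> c]) ->
  (forall x, essconst U (fun j => col Delta x (a j))) ->
  all_gammas Delta.
Proof.
move=> haa hab hg hx.
have [] := @greedy_pair U _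
  (([set i | U [set j | col Delta (a i) (a j) = p]]
     `&` [set i | U [set j | col Delta (a i) (b j) = g i]])
     `&` ([set i | g i <> None] `&` [set i | g i <> p]))
  (fun i => [set j | col Delta (a i) (a j) = p]
     `&` [set j | g j <> g i]).
- exact: filterI (filterI _ _) (filterI _ _).
- by move=> i [[hi _] _]; apply: filterI.
move=> x [hA hP].
pose X i := a (x i); pose G i := g (x i).
have GN i : G i <> None by case: (hA i) => _ [].
have Gp i : G i <> p by case: (hA i) => _ [].
have GG i j : i < j -> G i <> G j by move=> /hP [_ h]; apply/nesym.
have XX i j : i < j -> col Delta (X i) (X j) = p by move=> /hP [].
have Xa i : U [set j | col Delta (X i) (a j) = p] by case: (hA i) => [[]].
have apex n : exists y, forall i, i < n -> col Delta (X i) y = G i.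
  have [j hj] : exists j, forall i, i \in iota 0 n ->
      col Delta (X i) (b j) = G i.
    apply: (@filter_ex _ U); apply: (@filter_all _ _ U _ (iota 0 n)
      (fun i => [set j | col Delta (X i) (b j) = G i])) => i _.
    by case: (hA i) => [[]].
  by exists (b j) => i hi; apply: hj; rewrite mem_iota.
(* [t] lists the expected non-zero colours; to realise [p] inside it, two terms are required. *)
have gam_apex n t : uniq t -> {subset mkseq G n <= t} ->
    {subset t <= p :: mkseq G n} -> p \in None :: t ->
    (p \in t -> p <> None /\ 1 < n) -> exists s, gam Delta s = size t.
  move=> ut ht tp pt pn; have [y hy] := apex n; exists (y :: mkseq X n).
  apply: gam_eq_size => // [c ct|u v].
    apply/mem_cols; have := tp _ ct; rewrite inE => /orP [/eqP ep|].
      move: ct; rewrite ep => /pn [pN n1]; split=> //.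
      exists (X 0), (X 1); rewrite XX //.
      by split=> //; rewrite inE mem_mkseq ?orbT // ltnW.
    move=> /mem_mkseqP [i hi ->]; split; first exact: GN.
    exists (X i), y; rewrite hy //.
    by split; rewrite // inE ?eqxx // mem_mkseq ?orbT.
  have hGt i : i < n -> G i \in None :: t.
    by move=> hi; rewrite inE ht ?orbT // mem_mkseq.
  rewrite ![_ \in y :: _]in_cons => /orP [/eqP ->|us] /orP [/eqP ->|vs].
  - by rewrite colxx mem_head.
  - by case/mem_mkseqP: vs => i hi ->; rewrite colC hy // hGt.
  - by case/mem_mkseqP: us => i hi ->; rewrite hy // hGt.
  - apply: col_mkseq us vs => i j /andP [ij _]; by rewrite XX.
apply: all_gammas_gam => m.
have pG n : p \notin mkseq G n.
  by apply/negP => /mem_mkseqP [i _] /esym /Gp.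
have uG n : uniq (mkseq G n) by apply: uniq_mkseq.
have [p0|pN] := eqVneq p None.
  have [|||||s hs] := @gam_apex m (mkseq G m) => //.
  - by move=> c hc; rewrite inE hc orbT.
  - by rewrite p0 mem_head.
  - by rewrite (negbTE (pG m)).
  - by exists s; rewrite hs size_mkseq.
case: m => [|[|[|m]]]; first by exists [::].
(* The repeated vertex reduces the triangle to one edge. *)
- exists [:: X 0; X 1; X 1]; rewrite (@gam_triangle _ _ _ _ [:: p]) //.
  + by rewrite mem_seq1 eq_sym.
  + by move=> c; rewrite XX // !inE => ->.
  + by move=> c; rewrite XX // colxx !inE => /or3P [] ->; rewrite ?orbT.
(* Two colours: let [r] be the limit colour of the apex [y] along [a]. If [r] is [None] or [p], the
   triangle [X 0], [y], [a j] shows [G 0] and [p]; otherwise [y], [a j], [a k] shows [r] and [p]. *)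
- have [y /(_ 0 isT) hy] := apex 1.
  have [r hr] := hx y.
  have [j [[hj1 hj2] hj3]] := filter_ex (filterI (filterI (Xa 0) hr) haa).
  have [k [hk1 hk2]] := filter_ex (filterI hr hj3).
  rewrite /= in hj1 hj2 hk1 hk2.
  have [rt|rt] := boolP (r \in [:: None; p]).
    exists [:: X 0; y; a j]; rewrite (@gam_triangle _ _ _ _ [:: G 0; p]) //=.
    + by rewrite mem_seq1 andbT; apply/eqP/Gp.
    + by rewrite !inE negb_or ![None == _]eq_sym pN andbT; apply/eqP/GN.
    + by move=> c; rewrite hy hj1 !inE => /orP [] ->; rewrite ?orbT.
    + move=> c; rewrite hy hj1 hj2 !inE => /or3P [->|->|/eqP ->]; rewrite ?orbT //.
      by move: rt; rewrite !inE => /orP [] ->; rewrite ?orbT.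
  move: rt; rewrite !inE negb_or => /andP [rN rp].
  exists [:: y; a j; a k]; rewrite (@gam_triangle _ _ _ _ [:: r; p]) //=.
  + by rewrite mem_seq1 andbT.
  + by rewrite !inE negb_or ![None == _]eq_sym pN andbT.
  + by move=> c; rewrite hj2 hk2 !inE => /orP [] ->; rewrite ?orbT.
  + by move=> c; rewrite hj2 hk1 hk2 !inE => /or3P [] ->; rewrite ?orbT.
have [|||||s hs] := @gam_apex m.+2 (p :: mkseq G m.+2).
- by rewrite cons_uniq pG uG.
- by move=> c hc; rewrite inE hc orbT.
- by [].
- by rewrite !inE eqxx orbT.
- by split=> //; apply/eqP.
- by exists s; rewrite hs -cat1s size_cat size_mkseq.
Qed.

(** * Adding vertices with at most one new colour each *)

Definition realises_below (Delta : edge -> colour) (s : seq nat) : Prop :=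
  forall k, k <= gam Delta s -> exists s', gam Delta s' = k.

Lemma mem_None_cols (Delta : edge -> colour) (s : seq nat) (x y : nat) :
  x \in s -> y \in s -> col Delta x y \in None :: cols Delta s.
Proof.
move=> hx hy; rewrite inE; have [//|/eqP h] := eqVneq (col Delta x y) None.
by apply/mem_cols; split=> //; exists x, y.
Qed.

(** A discrete intermediate value argument: the count rises by at most one, so a value not covered
    by [s] is attained by [z :: s] itself. *)
Lemma realises_below_cons (Delta : edge -> colour) (s : seq nat) (z : nat)
    (d : colour) :
  realises_below Delta s ->
  (forall x, x \in s -> col Delta z x \in d :: None :: cols Delta s) ->
  realises_below Delta (z :: s).
Proof.
move=> hs h k; have [ks _|sk kz] := leqP k (gam Delta s); first exact: hs.
exists (z :: s); apply/eqP; rewrite eqn_leq kz andbT.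
apply: leq_trans sk.
apply: (@uniq_leq_size _ (cols Delta (z :: s)) (d :: cols Delta s)).
  exact: undup_uniq.
have old x : x \in s -> col Delta z x <> None ->
    col Delta z x \in d :: cols Delta s.
  move=> xs /eqP hn; have := h _ xs; rewrite !inE.
  by rewrite (negbTE hn).
move=> c /mem_cols [hn [x [y [hx hy ec]]]]; move: hn; rewrite ec.
move: hx hy; rewrite !inE => /orP [/eqP ->|xs] /orP [/eqP ->|ys].
- by rewrite colxx.
- by move/(old _ ys); rewrite inE.
- by rewrite colC; move/(old _ xs); rewrite inE.
- move=> /eqP hn; have := mem_None_cols Delta xs ys.
  by rewrite inE (negbTE hn) /= => ->; rewrite orbT.
Qed.

Section MatchingChain.

Variables (Delta : edge -> colour) (a b : nat -> nat) (p q r s : colour).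
Hypothesis aa : forall i j, i < j -> col Delta (a i) (a j) = p.
Hypothesis ab : forall i j, i < j -> col Delta (a i) (b j) = q.
Hypothesis ba : forall i j, i < j -> col Delta (b i) (a j) = r.
Hypothesis bb : forall i j, i < j -> col Delta (b i) (b j) = s.
Hypothesis mN : forall i, col Delta (a i) (b i) <> None.
Hypothesis mD :
  forall i j, i < j -> col Delta (a i) (b i) <> col Delta (a j) (b j).

(* The first four vertices realise all colours of cross pairs but [r] one at a
   time; afterwards each [a i] brings at most [r], and each [b i] at most the
   colour of its matching edge. *)
Fixpoint matching_chain (n : nat) : seq nat :=
  if n is k.+1 then b (k + 4) :: a (k + 4) :: matching_chain k
  else [:: b 3; b 2; a 1; a 0].

Lemma matching_chain_index (n x : nat) :
  x \in matching_chain n -> exists2 i, i < n + 4 & x = a i \/ x = b i.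
Proof.
elim: n => [|n ih] /=; rewrite !inE.
  by case/or4P => /eqP ->; [exists 3|exists 2|exists 1|exists 0] => //; auto.
case/or3P => [/eqP ->|/eqP ->|/ih [i hi h]].
- by exists (n + 4); [rewrite addSn|right].
- by exists (n + 4); [rewrite addSn|left].
- by exists i => //; rewrite addSn ltnS ltnW.
Qed.

Lemma matching_chain_start (n : nat) :
  {subset [:: b 3; b 2; a 1; a 0] <= matching_chain n}.
Proof. by elim: n => [//|n ih] x /ih h; rewrite /= !inE h !orbT. Qed.

Lemma matching_chain_realises (n : nat) :
  realises_below Delta (matching_chain n).
Proof.
elim: n => [|n ih].
  (* The four vertices enter from the right; their distinct indices keep matching edges out. *)
  have h0 : realises_below Delta [::].
    by move=> k; rewrite leqn0 => /eqP ->; exists [::].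
  have h1 : realises_below Delta [:: a 0].
    by apply: (@realises_below_cons _ _ _ None h0).
  have h2 : realises_below Delta [:: a 1; a 0].
    apply: (@realises_below_cons _ _ _ p h1) => x.
    by rewrite inE => /eqP ->; rewrite colC aa // in_cons eqxx.
  have h3 : realises_below Delta [:: b 2; a 1; a 0].
    apply: (@realises_below_cons _ _ _ q h2) => x.
    by rewrite in_cons mem_seq1 => /orP [] /eqP ->; rewrite colC ab // in_cons eqxx.
  apply: (@realises_below_cons _ _ _ s h3) => x.
  rewrite !in_cons in_nil orbF => /or3P [] /eqP ->; rewrite colC.
  - by rewrite bb // eqxx.
  - rewrite ab // -(@ab 0 2) // -in_cons mem_None_cols ?orbT //.
      by rewrite !inE eqxx !orbT.
    by rewrite !inE eqxx.
  - rewrite ab // -(@ab 0 2) // -in_cons mem_None_cols ?orbT //.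
      by rewrite !inE eqxx !orbT.
    by rewrite !inE eqxx.
have start := @matching_chain_start n.
(* [p], like [q] and [s] below, is [None] or already seen on the four starting vertices. *)
have hp : p \in None :: cols Delta (matching_chain n).
  by rewrite -(@aa 0 1) //; apply: mem_None_cols; apply: start;
     rewrite !inE eqxx ?orbT.
have ha : realises_below Delta (a (n + 4) :: matching_chain n).
  apply: (@realises_below_cons _ _ _ r ih) => x /matching_chain_index.
  case=> i hi [] ->; rewrite colC.
    by rewrite aa // in_cons hp orbT.
  by rewrite ba // in_cons eqxx.
have start' x : x \in [:: b 3; b 2; a 1; a 0] ->
    x \in a (n + 4) :: matching_chain n.
  by move=> /start h; rewrite inE h orbT.
have hq : q \in None :: cols Delta (a (n + 4) :: matching_chain n).
  by rewrite -(@ab 0 2) //; apply: mem_None_cols; apply: start';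
     rewrite !inE eqxx ?orbT.
have hs : s \in None :: cols Delta (a (n + 4) :: matching_chain n).
  by rewrite -(@bb 2 3) //; apply: mem_None_cols; apply: start';
     rewrite !inE eqxx ?orbT.
apply: (@realises_below_cons _ _ _ (col Delta (a (n + 4)) (b (n + 4))) ha) => x.
rewrite in_cons => /orP [/eqP ->|/matching_chain_index [i hi [] ->]].
- by rewrite colC in_cons eqxx.
- by rewrite colC ab // in_cons hq orbT.
- by rewrite colC bb // in_cons hs orbT.
Qed.

Lemma leq_gam_matching_chain (n : nat) : n <= gam Delta (matching_chain n).
Proof.
pose c i := col Delta (a (i + 4)) (b (i + 4)).
rewrite -[X in X <= _](size_mkseq c); apply: uniq_leq_size.
  by apply: uniq_mkseq => i j ij; apply: mD; rewrite ltn_add2r.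
move=> _ /mem_mkseqP [i hi ->]; apply/mem_cols; split; first exact: mN.
exists (a (i + 4)), (b (i + 4)).
suff h : a (i + 4) \in matching_chain n /\ b (i + 4) \in matching_chain n.
  by case: h.
elim: n hi => [//|n ih]; rewrite ltnS leq_eqVlt /= !in_cons.
by case/orP => [/eqP ->|/ih [-> ->]]; rewrite ?eqxx ?orbT.
Qed.

Lemma all_gammas_matching : all_gammas Delta.
Proof.
apply: all_gammas_gam => m.
exact: (matching_chain_realises (leq_gam_matching_chain m)).
Qed.

End MatchingChain.

(** * Finitely many colours at each vertex, and conclusion *)

Lemma ultra_matching (Delta : edge -> colour) (U : set_system nat)
    (UU : UltraFilter U) (a b : nat -> nat) :
  (forall i, U [set j | j <> i]) ->
  (forall i, col Delta (a i) (b i) <> None) ->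
  injective (fun i => col Delta (a i) (b i)) ->
  (forall x, finite_set (range (col Delta x))) ->
  all_gammas Delta.
Proof.
move=> free mN mD fin.
have con (c : nat -> nat) x : essconst U (fun j => col Delta x (c j)).
  apply: (essconst_finite UU); apply: sub_finite_set (fin x).
  by move=> _ [j _ <-]; exists (c j).
pose phi (c d : nat -> nat) i := ess_value U (fun j => col Delta (c i) (d j)).
have phiP c d i : U [set j | col Delta (c i) (d j) = phi c d i].
  exact: ess_valueP (con d (c i)).
have phiU c d : U [set i | U [set j | col Delta (c i) (d j) = phi c d i]].
  by apply: filterS filterT => i _; exact: phiP.
have shift c d v : U [set i | phi c d i = v] ->
    U [set i | U [set j | col Delta (c i) (d j) = v]].
  by apply: filterS => i /= <-; exact: phiP.
have diag c : (exists v, U [set i | phi c c i = v]) \/ all_gammas Delta.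
  have [h|/(nessconstP UU) h] := pselect (essconst U (phi c c)); first by left.
  by right; apply: (all_gammas_ultra_min UU (phiU c c)).
(* The constant diagonal limit supplies the monochromatic sequence that [all_gammas_cross] starts
   from. *)
have cross c d v : U [set i | phi c c i = v] ->
    (exists w, U [set i | phi c d i = w]) \/ all_gammas Delta.
  move=> /shift hv.
  have [h|/(nessconstP UU) h] := pselect (essconst U (phi c d)); first by left.
  by right; apply: (all_gammas_cross UU hv (phiU c d) h) => x; exact: con.
have [[p hp]|//] := diag a.
have [[s hs]|//] := diag b.
have [[q hq]|//] := cross a b p hp.
have [[r hr]|//] := cross b a s hs.
have [] := @greedy_pair U _
  (([set i | phi a a i = p] `&` [set i | phi a b i = q])
     `&` ([set i | phi b a i = r] `&` [set i | phi b b i = s]))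
  (fun i => ([set j | col Delta (a i) (a j) = phi a a i]
       `&` [set j | col Delta (a i) (b j) = phi a b i])
     `&` ([set j | col Delta (b i) (a j) = phi b a i]
       `&` [set j | col Delta (b i) (b j) = phi b b i])
     (* This makes [x] injective, so the matching colours stay distinct. *)
     `&` [set j | j <> i]).
- exact: filterI (filterI _ _) (filterI _ _).
- move=> i _; apply: filterI (free i).
  by apply: filterI; apply: filterI; exact: phiP.
move=> x [hA hP].
have hA' i : [/\ phi a a (x i) = p, phi a b (x i) = q,
    phi b a (x i) = r & phi b b (x i) = s] by case: (hA i) => [[? ?] [? ?]].
apply: (@all_gammas_matching _ (a \o x) (b \o x) p q r s) => [i j ij|i j ij|i j ij|i j ij|i|i j ij] /=.
- by have [<- _ _ _] := hA' i; case: (hP _ _ ij) => [[[]]].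
- by have [_ <- _ _] := hA' i; case: (hP _ _ ij) => [[[]]].
- by have [_ _ <- _] := hA' i; case: (hP _ _ ij) => [[_ []]].
- by have [_ _ _ <-] := hA' i; case: (hP _ _ ij) => [[_ []]].
- exact: mN.
- by move=> /mD e; case: (hP _ _ ij) => _; apply.
Qed.

(** Removing [None] leaves infinitely many colours; inject the naturals into them and choose an edge
    for each. *)
Lemma infinite_colours (Delta : edge -> colour) :
  infinite_set (range Delta) ->
  exists a b : nat -> nat, (forall i, col Delta (a i) (b i) <> None) /\
    injective (fun i => col Delta (a i) (b i)).
Proof.
move=> hinf.
have /infiniteP /(@pcard_leP _ (option nat)) [f] : infinite_set (range Delta `\ None).
  by apply: infinite_setD => //; exact: finite_set1.
have /choice [e he] i : exists e : nat * nat,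
    f i <> None /\ f i = col Delta e.1 e.2.
  have [[e _ <-] hn] : (range Delta `\ None) (f i) by exact: funS.
  have [x [y [hxy ee]]] := edgeP e.
  by exists (x, y); split=> //; apply: colE.
exists (fst \o e), (snd \o e); split=> [i|i j] /=.
  by have [hn <-] := he i.
have [_ <-] := he i; have [_ <-] := he j.
by apply: inj; rewrite inE.
Qed.

Theorem theorem6 (Delta : edge -> colour) (hinf : infinite_set (range Delta)) :
  [\/ forall m : nat, exists X : set nat, gamma_eq Delta X m,
      exists X : set nat, infinite_set X /\ rainbow Delta X
    | exists X : set nat, infinite_set X /\ star_coloured Delta X].
Proof.
have [[v hv]|fin] :=
  pselect (exists v, infinite_set (range (col Delta v))).
  exact: infinite_degree hv.
have [a [b [mN mD]]] := infinite_colours hinf.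
(* For the identity, avoiding every value means that [U] is free; it lives on the indices of the
   pairs. *)
have [|U [UU free]] := @ultra_of_infinite nat id.
  by apply: infinite_range_lt => i j ij /= eij; rewrite eij ltnn in ij.
constructor 1; apply: (ultra_matching UU free mN mD) => x.
by apply: contrapT => hx; apply: fin; exists x.
Qed.
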